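(* Let $L>0$ and $M>0$ be constants, and let $N$ be a real constant with $$|N|\le \frac{8M}{L^3}.$$ Then for every $p\in L^1[0,L]$ the nonlocal boundary value problem $$y^{(4)}(x)-My''(x)+N\int_0^L y(t)\,dt=p(x)\ \ \text{for a.e. } x\in(0,L),\qquad y(0)=y(L)=y''(0)=y''(L)=0,$$ has a unique solution $y\in W^{4,1}[0,L]$, and it is given by $$y(x)=\int_0^L G(x,s)p(s)\,ds-\frac{N\int_0^L G(x,s)\,ds}{1+N\int_0^L\!\int_0^L G(x,s)\,ds\,dx}\int_0^L\!\int_0^L G(x,s)p(s)\,ds\,dx,\qquad x\in[0,L].$$
   Context: $G$ is the Green function of $y''''-My''=0$ with the boundary conditions $y(0)=y(L)=y''(0)=y''(L)=0$, explicitly $$G(x,s)=\begin{cases}\dfrac{x(L-s)}{ML}-\dfrac{\sinh(\sqrt M x)\sinh(\sqrt M(L-s))}{M\sqrt M\sinh(\sqrt M L)}, & 0\le x\le s\le L,\\[2mm] \dfrac{s(L-x)}{ML}-\dfrac{\sinh(\sqrt M s)\sinh(\sqrt M(L-x))}{M\sqrt M\sinh(\sqrt M L)}, & 0\le s\le x\le L.\end{cases}$$ *)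

(* Defs.v *)
From HB Require Import structures.
From mathcomp Require Import all_boot all_order all_algebra.
From mathcomp Require Import all_classical all_reals all_analysis.
Set Implicit Arguments. Unset Strict Implicit. Unset Printing Implicit Defensive.
Import Order.TTheory GRing.Theory Num.Theory.
Import numFieldNormedType.Exports.
Local Open Scope classical_set_scope.
Local Open Scope ring_scope.

Section Defs.
Variable R : realType.

Definition leb := (@lebesgue_measure R).

Definition Iab (a b : R) (f : R -> R) : R := \int[leb]_(x in `[a, b]) f x.

Definition sinh (x : R) : R := (expR x - expR (- x)) / 2.

(* Green function of y'''' - M y'' = 0, y(0)=y(L)=y''(0)=y''(L)=0 *)
Definition G (M L x s : R) : R :=
  let m := Num.sqrt M in
  if x <= s then
    x * (L - s) / (M * L) - sinh (m * x) * sinh (m * (L - s)) / (M * m * sinh (m * L))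
  else
    s * (L - x) / (M * L) - sinh (m * s) * sinh (m * (L - x)) / (M * m * sinh (m * L)).

Definition L1 (L : R) (p : R -> R) : Prop :=
  leb.-integrable `[0, L] (EFin \o p).

(* y in W^{4,1}[0,L], with y', y'', y''', y'''' given by y1..y4:
   y^(k) is absolutely continuous (the indefinite integral of the integrable
   y^(k+1)) on [0,L] for k = 0..3, and y'''' in L^1[0,L]. *)
Definition W41 (L : R) (y y1 y2 y3 y4 : R -> R) : Prop :=
  [/\ L1 L y1, L1 L y2, L1 L y3, L1 L y4 &
   forall x, x \in `[0, L] ->
     [/\ y x = y 0 + Iab 0 x y1,
         y1 x = y1 0 + Iab 0 x y2,
         y2 x = y2 0 + Iab 0 x y3 &
         y3 x = y3 0 + Iab 0 x y4]].

Definition is_solution (M N L : R) (p y : R -> R) : Prop :=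
  exists y1 y2 y3 y4 : R -> R,
    [/\ W41 L y y1 y2 y3 y4,
        {ae leb, forall x, x \in `]0, L[ ->
           y4 x - M * y2 x + N * Iab 0 L y = p x} &
        [/\ y 0 = 0, y L = 0, y2 0 = 0 & y2 L = 0]].

Definition sol_formula (M N L : R) (p : R -> R) (x : R) : R :=
  Iab 0 L (fun s => G M L x s * p s)
  - N * Iab 0 L (fun s => G M L x s)
    / (1 + N * Iab 0 L (fun x' => Iab 0 L (fun s => G M L x' s)))
    * Iab 0 L (fun x' => Iab 0 L (fun s => G M L x' s * p s)).

End Defs.

(* Main.v *)
Require Import Defs.
From HB Require Import structures.
From mathcomp Require Import all_boot all_order all_algebra.
From mathcomp Require Import all_classical all_reals all_analysis.
From mathcomp Require Import measurable_realfun ring lra.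
Import Order.TTheory GRing.Theory Num.Theory.
Import numFieldNormedType.Exports.
Local Open Scope classical_set_scope.
Local Open Scope ring_scope.

(** Everything rests on the product rule for absolutely continuous functions,
which is Fubini's theorem on a triangle. Integrating by parts on [0, x] and on
[x, L], where s |-> G(x, s) is smooth, shows that a function y satisfying the
boundary conditions equals V(y'''' - M y''), where V q := \int G(., s) q(s) ds.
Conversely y'''' - M y'' = q is solved by variation of constants for y'', and
the solution found in this way must be V q, so G is never differentiated in x.
A solution of the nonlocal problem is thus a y with y = V p - N c V 1, where
c = \int y, and integrating this over [0, L] gives c (1 + N U) = \int V p with
U = \int V 1. Energy identities for u = V 1 give 0 <= U <= L^3 / (12 M), hence
|N| U <= 2 / 3 and the denominator 1 + N U is positive. *)

(** * Fubini's theorem on a triangle *)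

Section triangle.
Context {R : realType}.
Notation mu := (@lebesgue_measure R).
Implicit Types f g : R -> R.

(** By Tonelli, the integral of |f(x) g(y)| over the plane is a product of two finite integrals. *)
Lemma integrable_prod_EFin {f g} :
  mu.-integrable setT (EFin \o f) -> mu.-integrable setT (EFin \o g) ->
  (mu \x mu)%E.-integrable setT (EFin \o (fun z => f z.1 * g z.2)).
Proof.
move=> fi gi.
have mf : measurable_fun setT f.
  by apply/measurable_EFinP; exact: measurable_int fi.
have mg : measurable_fun setT g.
  by apply/measurable_EFinP; exact: measurable_int gi.
have mfg : measurable_fun setT (EFin \o (fun z : R * R => f z.1 * g z.2)).
  by apply/measurable_EFinP; apply: measurable_funM; apply: measurableT_comp.
apply: (integrable12ltyP mu mu mfg).2.
have -> : (\int[mu]_x \int[mu]_y `|(f x * g y)%R%:E| =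
  \int[mu]_x (`|(f x)%:E| * \int[mu]_y `|(g y)%:E|))%E.
  apply: eq_integral => x _ /=.
  rewrite -ge0_integralZl_EFin //=; last first.
    by apply/measurable_EFinP; exact: measurableT_comp.
  by apply: eq_integral => y _; rewrite normrM EFinM.
have /integrableP[_ gy] := gi.
have /integrableP[_ fy] := fi.
rewrite ge0_integralZr//; last 2 first.
- by apply: measurableT_comp => //; exact: measurable_int fi.
- exact: integral_ge0.
by rewrite lte_mul_pinfty// ?integral_ge0// ge0_fin_numE// integral_ge0.
Qed.

(** Both sides are iterated integrals of f(t) g(s) over the triangle 0 <= s <= t <= b, taken in the
    two orders. *)
Lemma Rintegral_triangle f g (b : R) :
  mu.-integrable `[0, b] (EFin \o f) -> mu.-integrable `[0, b] (EFin \o g) ->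
  \int[mu]_(t in `[0, b]) (f t * \int[mu]_(s in `[0, t]) g s) =
  \int[mu]_(s in `[0, b]) (g s * \int[mu]_(t in `[s, b]) f t).
Proof.
move=> fi gi.
pose f0 := f \_ `[0, b]; pose g0 := g \_ `[0, b].
have f0i : mu.-integrable setT (EFin \o f0).
  by rewrite /f0 -restrict_EFin; apply/integrable_restrict => //=; rewrite setTI.
have g0i : mu.-integrable setT (EFin \o g0).
  by rewrite /g0 -restrict_EFin; apply/integrable_restrict => //=; rewrite setTI.
(* Extension by zero and the cut-off s <= t move the triangle to the whole plane, where [h] is
   dominated by the integrable product of [f0] and [g0]. *)
pose h (z : R * R) := if z.2 <= z.1 then f0 z.1 * g0 z.2 else 0.
have mf : measurable_fun setT f0.
  by apply/measurable_EFinP; exact: measurable_int f0i.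
have mg : measurable_fun setT g0.
  by apply/measurable_EFinP; exact: measurable_int g0i.
have mh : measurable_fun setT (EFin \o h).
  apply/measurable_EFinP; apply: measurable_fun_ifT => //.
    by apply: measurable_fun_ler.
  by apply: measurable_funM; apply: measurableT_comp.
have ih : (mu \x mu)%E.-integrable setT (EFin \o h).
  apply: le_integrable (integrable_prod_EFin f0i g0i) => // z _ /=.
  by rewrite /h lee_fin; case: ifP => // _; rewrite normr0.
pose u t := f t * \int[mu]_(s in `[0, t]) g s.
pose v s := g s * \int[mu]_(t in `[s, b]) f t.
have := Fubini ih.
rewrite (_ : (\int[mu]_x \int[mu]_y (EFin \o h) (x, y) =
   \int[mu]_(t in `[0%R, b]) (u t)%:E)%E); last first.
  rewrite [RHS]integral_mkcond; apply: eq_integral => t _.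
  rewrite patchE; case: ifPn => tb; last first.
    under eq_integral do rewrite /= /h /f0 patchE (negbTE tb) mul0r if_same.
    by rewrite integral0.
  have t0b : 0 <= t <= b by move: tb; rewrite inE /= in_itv.
  have gti : mu.-integrable `[0, t] (EFin \o g).
    apply: integrableS gi => //; apply: subset_itvl; rewrite bnd_simp.
    by case/andP: t0b.
  rewrite /u -RintegralZl// /Rintegral fineK; last first.
    by apply: integrable_fin_num => //; exact: (integrableZl _ (f t) gti).
  rewrite [RHS]integral_mkcond; apply: eq_integral => s _.
  rewrite /= /h /f0 /g0 !patchE tb /= !mem_setE !in_itv /=.
  case: (leP s t) => st; rewrite ?andbT ?andbF; last by [].
  have -> : s <= b by lra.
  by rewrite andbT; case: ifP => // _; rewrite (mulr0 (f t)).
rewrite (_ : (\int[mu]_y \int[mu]_x (EFin \o h) (x, y) =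
   \int[mu]_(s in `[0%R, b]) (v s)%:E)%E); last first.
  rewrite [RHS]integral_mkcond; apply: eq_integral => s _.
  rewrite patchE; case: ifPn => sb; last first.
    under eq_integral do rewrite /= /h /g0 patchE (negbTE sb) mulr0 if_same.
    by rewrite integral0.
  have s0b : 0 <= s <= b by move: sb; rewrite inE /= in_itv.
  have fsi : mu.-integrable `[s, b] (EFin \o f).
    apply: integrableS fi => //; apply: subset_itvr; rewrite bnd_simp.
    by case/andP: s0b.
  rewrite /v -RintegralZl// /Rintegral fineK; last first.
    by apply: integrable_fin_num => //; exact: (integrableZl _ (g s) fsi).
  rewrite [RHS]integral_mkcond; apply: eq_integral => t _.
  rewrite /= /h /f0 /g0 !patchE sb /= !mem_setE !in_itv /=.
  case: (leP s t) => st //=.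
  have -> : 0 <= t by lra.
  by rewrite andTb mulrC; case: ifP => // _; rewrite (mulr0 (g s)).
by move=> e; rewrite /Rintegral e.
Qed.

End triangle.

(* F is absolutely continuous on [0, L] with a.e. derivative f. *)
Definition abs_cont {R : realType} (L : R) (F f : R -> R) : Prop :=
  L1 L f /\ forall x, x \in `[0, L] -> F x = F 0 + Iab 0 x f.

(** * Integrable functions and their integrals over subintervals of [0, L] *)

Section integrable_functions.
Context {R : realType} {L : R}.
Implicit Types (f g h : R -> R) (a b x k : R).

Lemma L1_itv {f a b} : a \in `[0, L] -> b \in `[0, L] -> L1 L f ->
  (@leb R).-integrable `[a, b] (EFin \o f).
Proof.
rewrite !in_itv /= => /andP[a0 _] /andP[_ bL]; apply: integrableS => //.
by apply: subset_itv; rewrite bnd_simp.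
Qed.

Lemma L1_eq {f g} : {in `[0, L], f =1 g} -> L1 L f -> L1 L g.
Proof.
move=> fg; apply: eq_integrable => // x; rewrite inE /= => xL.
by rewrite fg.
Qed.

Lemma L1D {f g} : L1 L f -> L1 L g -> L1 L (fun x => f x + g x).
Proof. by move=> fi gi; apply: eq_integrable (integrableD _ fi gi). Qed.

Lemma L1Z k {f} : L1 L f -> L1 L (fun x => k * f x).
Proof. by move=> fi; apply: eq_integrable (integrableZl _ k fi). Qed.

Lemma L1B {f g} : L1 L f -> L1 L g -> L1 L (fun x => f x - g x).
Proof. by move=> fi gi; apply: eq_integrable (integrableB _ fi gi). Qed.

Lemma L1_cst k : L1 L (fun=> k).
Proof.
apply: continuous_compact_integrable; first exact: segment_compact.
by apply: continuous_subspaceT => x; exact: cst_continuous.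
Qed.

Lemma L1_measurable {f} : L1 L f -> measurable_fun `[0, L] f.
Proof. by move=> fi; apply/measurable_EFinP; exact: measurable_int fi. Qed.

Lemma L1_if {c : R -> bool} {f g} : measurable_fun setT c ->
  L1 L f -> L1 L g -> L1 L (fun x => if c x then f x else g x).
Proof.
move=> mb fi gi.
apply: le_integrable
  (integrableD _ (integrable_abse fi) (integrable_abse gi)) => //.
  apply/measurable_EFinP; apply: measurable_fun_if => //.
  - exact: measurable_funTS.
  - exact: measurable_funS (L1_measurable fi).
  - exact: measurable_funS (L1_measurable gi).
move=> x _; rewrite /= lee_fin (@ger0_norm _ (`|f x| + `|g x|)) ?addr_ge0//.
by case: ifP => _; rewrite ?lerDl ?lerDr.
Qed.

Lemma Iab_eq {f g a b} : {in `[a, b], f =1 g} -> Iab a b f = Iab a b g.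
Proof. by move=> fg; apply: eq_Rintegral => x; rewrite inE => /fg. Qed.

(** The endpoints are null; this lets an equation known only on the open interval be used under
    [Iab]. *)
Lemma Iab_itvoo f a b : (@leb R).-integrable `[a, b] (EFin \o f) ->
  Iab a b f = \int[@leb R]_(x in `]a, b[) f x.
Proof.
move=> fi.
rewrite /Iab Rintegral_itv_bndo_bndc; last first.
  by apply: integrableS fi => //; exact: subset_itv_oo_cc.
rewrite Rintegral_itv_obnd_cbnd//.
by apply: integrableS fi => //; apply: subset_itvr; rewrite bnd_simp.
Qed.

Lemma Iab_ae_eq f g : L1 L f -> L1 L g ->
  {ae @leb R, forall x, x \in `]0, L[ -> f x = g x} -> Iab 0 L f = Iab 0 L g.
Proof.
move=> fi gi fg; rewrite !Iab_itvoo//; congr fine.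
apply: ae_eq_integral => //.
- by apply: measurable_int (integrableS _ _ _ fi) => //; exact: subset_itv_oo_cc.
- by apply: measurable_int (integrableS _ _ _ gi) => //; exact: subset_itv_oo_cc.
- move: fg; apply: filterS; first exact: (ae_filter_ringOfSetsType (@leb R)).
  by move=> x fg xL; rewrite /= fg.
Qed.

Lemma Iab_id f a : Iab a a f = 0.
Proof. by rewrite /Iab set_itv1 Rintegral_set1. Qed.

Lemma IabD {f g a b} : a \in `[0, L] -> b \in `[0, L] -> L1 L f -> L1 L g ->
  Iab a b (fun x => f x + g x) = Iab a b f + Iab a b g.
Proof. by move=> aL bL fi gi; apply: RintegralD => //; exact: L1_itv. Qed.

Lemma IabB {f g a b} : a \in `[0, L] -> b \in `[0, L] -> L1 L f -> L1 L g ->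
  Iab a b (fun x => f x - g x) = Iab a b f - Iab a b g.
Proof. by move=> aL bL fi gi; apply: RintegralB => //; exact: L1_itv. Qed.

Lemma IabZ k {f a b} : a \in `[0, L] -> b \in `[0, L] -> L1 L f ->
  Iab a b (fun x => k * f x) = k * Iab a b f.
Proof. by move=> aL bL fi; apply: RintegralZl => //; exact: L1_itv. Qed.

Lemma Iab_split {f a b x} : a \in `[0, L] -> b \in `[0, L] -> x \in `[a, b] ->
  L1 L f -> Iab a b f = Iab a x f + Iab x b f.
Proof.
move=> aL bL; rewrite in_itv /= => /andP[ax xb] fi.
have fab := L1_itv aL bL fi.
have := @Rintegral_itvB _ f (BLeft a) (BRight b) x fab.
rewrite !bnd_simp => /(_ ax xb) e.
rewrite /Iab -(@Rintegral_itv_obnd_cbnd _ x (BRight b)); last first.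
  by apply: integrableS fab => //; apply: subset_itvr; rewrite bnd_simp.
by rewrite -e addrC subrK.
Qed.

(** The indefinite integral of g is continuous on a compact interval, hence measurable and bounded
    there. *)
Lemma L1_mul_Iab {f g} : L1 L f -> L1 L g -> L1 L (fun x => f x * Iab 0 x g).
Proof.
have [L0|L0] := leP 0 L; last first.
  by rewrite /L1 set_itv_ge ?bnd_simp -?ltNge // => _ _; exact: integrable_set0.
move=> fi gi; have ci := parameterized_integral_continuous L0 gi.
have mi : measurable_fun `[0, L] (Iab 0 ^~ g).
  exact: subspace_continuous_measurable_fun.
have bi : [bounded Iab 0 x g | x in `[0, L]].
  have /compact_bounded[K [_ HK]] :=
    continuous_compact ci (@segment_compact _ 0 L).
  by exists K; split; rewrite ?num_real// => r Kr x xL; apply: HK => //; exists x.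
exact: eq_integrable (integrableMl _ fi mi bi).
Qed.

End integrable_functions.

Definition cosh {R : realType} (x : R) : R := (expR x + expR (- x)) / 2.

(** * Calculus of absolutely continuous functions *)

Section absolutely_continuous.
Context {R : realType} {L : R}.
Implicit Types (f g F G : R -> R) (a b x k : R).

Let in_itv0 x : x \in `[0, L] -> 0 \in `[0, L].
Proof. by rewrite !in_itv /= lexx => /andP[/le_trans]; apply. Qed.

Lemma AC_eq {F F' f f'} : {in `[0, L], F =1 F'} -> {in `[0, L], f =1 f'} ->
  abs_cont L F f -> abs_cont L F' f'.
Proof.
move=> FF' ff' [fi Ff]; split; first exact: L1_eq fi.
move=> x xL; rewrite -!FF' ?(in_itv0 _ xL)// Ff//; congr (_ + _).
apply: Iab_eq => y yx; apply: ff'; move: yx xL; rewrite !in_itv /=; lra.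
Qed.

Lemma ACD {F f G g} : abs_cont L F f -> abs_cont L G g ->
  abs_cont L (fun x => F x + G x) (fun x => f x + g x).
Proof.
move=> [fi Ff] [gi Gg]; split; first exact: L1D.
by move=> x xL; rewrite (@IabD _ L) ?(in_itv0 _ xL)// Ff// Gg//; ring.
Qed.

Lemma ACZ k {F f} : abs_cont L F f ->
  abs_cont L (fun x => k * F x) (fun x => k * f x).
Proof.
move=> [fi Ff]; split; first exact: L1Z.
by move=> x xL; rewrite (@IabZ _ L) ?(in_itv0 _ xL)// Ff//; ring.
Qed.

Lemma ACB {F f G g} : abs_cont L F f -> abs_cont L G g ->
  abs_cont L (fun x => F x - G x) (fun x => f x - g x).
Proof.
move=> AF AG; apply: AC_eq (ACD AF (ACZ (-1) AG)) => x _; ring.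
Qed.

Lemma AC_Iab {f} : L1 L f -> abs_cont L (Iab 0 ^~ f) f.
Proof. by move=> fi; split => // x xL; rewrite Iab_id add0r. Qed.

Lemma AC_cst k : abs_cont L (fun=> k) (fun=> 0).
Proof.
split=> [|x xL]; first exact: L1_cst.
by rewrite /Iab Rintegral_cst// mul0r addr0.
Qed.

Lemma L1M {f G g} : L1 L f -> abs_cont L G g -> L1 L (fun x => f x * G x).
Proof.
move=> fi [gi Gg].
apply: L1_eq (L1D (L1Z (G 0) fi) (L1_mul_Iab fi gi)) => x xL.
by rewrite [G x]Gg//; ring.
Qed.

Lemma L1_AC {F f} : abs_cont L F f -> L1 L F.
Proof.
by move=> AF; apply: L1_eq (L1M (L1_cst 1) AF) => x _; rewrite mul1r.
Qed.

Lemma AC_increment {F f a b} : a \in `[0, L] -> b \in `[0, L] -> a <= b ->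
  abs_cont L F f -> Iab a b f = F b - F a.
Proof.
move=> aL bL ab [fi Ff]; have zL := in_itv0 _ aL.
have ab' : a \in `[0, b] by move: aL; rewrite !in_itv /= ab => /andP[->].
by rewrite (Ff b)// (Ff a)// (Iab_split zL bL ab' fi); ring.
Qed.

(** This is the product rule for functions vanishing at 0. The triangle identity turns the first
    term into the integral of g(s) times \int_s^x f = \int_0^x f - \int_0^s f, and the subtracted
    part cancels the second term. *)
Lemma Iab_mul {f g x} : x \in `[0, L] -> L1 L f -> L1 L g ->
  Iab 0 x (fun t => f t * Iab 0 t g + Iab 0 t f * g t) = Iab 0 x f * Iab 0 x g.
Proof.
move=> xL fi gi; have zL := in_itv0 _ xL.
rewrite (@IabD _ L)//; [|exact: L1_mul_Iab|]; last first.
  by apply: L1_eq (L1_mul_Iab gi fi) => t _; rewrite mulrC.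
rewrite {1}/Iab (Rintegral_triangle f g x); [|exact: (@L1_itv _ L)..].
rewrite -[X in X + _]/(Iab 0 x (fun s => g s * Iab s x f)).
rewrite (@Iab_eq _ _ (fun s => Iab 0 x f * g s - g s * Iab 0 s f)); last first.
  move=> s sx; rewrite (Iab_split zL xL sx fi); ring.
rewrite (@IabB _ L)//; [|exact: L1Z|exact: L1_mul_Iab].
rewrite (@IabZ _ L)//.
rewrite (_ : Iab 0 x (fun t => Iab 0 t f * g t) =
  Iab 0 x (fun t => g t * Iab 0 t f)).
  by rewrite subrK.
by apply: Iab_eq => t _; rewrite mulrC.
Qed.

(** Writing F = F(0) + \int f and G = G(0) + \int g leaves [Iab_mul] and terms linear in f and g. *)
Lemma ACM {F f G g} : abs_cont L F f -> abs_cont L G g ->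
  abs_cont L (fun x => F x * G x) (fun x => f x * G x + F x * g x).
Proof.
move=> AF AG; have [fi Ff] := AF; have [gi Gg] := AG.
have fGi : L1 L (fun x => f x * G x) by apply: L1M AG.
have Fgi : L1 L (fun x => F x * g x).
  by apply: L1_eq (L1M gi AF) => x _; rewrite mulrC.
split; first exact: L1D.
move=> x xL; have zL := in_itv0 _ xL.
rewrite (@Iab_eq _ _ (fun t => (G 0 * f t + F 0 * g t) +
  (f t * Iab 0 t g + Iab 0 t f * g t))); last first.
  move=> t tx; have tL : t \in `[0, L] by move: tx xL; rewrite !in_itv /=; lra.
  rewrite (Ff t)// (Gg t)//; ring.
have h1 := L1Z (G 0) fi; have h2 := L1Z (F 0) gi.
rewrite (@IabD _ L)//; [|exact: L1D|]; last first.
  apply: L1D; first exact: L1_mul_Iab.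
  by apply: L1_eq (L1_mul_Iab gi fi) => t _; rewrite mulrC.
rewrite Iab_mul// (@IabD _ L)// !(@IabZ _ L)// (Ff x)// (Gg x)//; ring.
Qed.

Lemma AC_C1 {F f} : (forall x, is_derive x 1 F (f x)) -> continuous f ->
  abs_cont L F f.
Proof.
move=> dF cf; split.
  apply: continuous_compact_integrable; first exact: segment_compact.
  exact: continuous_subspaceT.
move=> x; rewrite in_itv /= => /andP[]; rewrite le_eqVlt => /predU1P[<- _|x0 _].
  by rewrite Iab_id addr0.
have cF y : {for y, continuous F}.
  by apply: differentiable_continuous; apply/derivable1_diffP; exact: ex_derive.
rewrite /Iab /Rintegral (continuous_FTC2 (F := F))//.
- by rewrite -EFinB /=; ring.
- exact: continuous_subspaceT.
- split => [y _||]; first exact: ex_derive.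
  + by apply: cvg_at_right_filter; exact: cF.
  + by apply: cvg_at_left_filter; exact: cF.
- by move=> y _; rewrite derive1E; apply: derive_val.
Qed.

Lemma AC_id : abs_cont L id (fun=> 1).
Proof. apply: AC_C1 => x; exact: cst_continuous. Qed.

(** Affine arguments serve both sinh(m s) and sinh(m (L - s)) in the two branches of G. *)
Lemma AC_expR a b :
  abs_cont L (fun x => expR (a * x + b)) (fun x => a * expR (a * x + b)).
Proof.
have daff x : is_derive x 1 (fun x => a * x + b : R) a.
  rewrite (_ : (fun x => _) = cst a * id + cst b)//.
  by apply: is_derive_eq; rewrite scaler0 !addr0 /cst /= -[RHS]mulr1.
apply: AC_C1 => x; first by rewrite mulrC; exact: is_derive1_comp.
apply: cvgM; first exact: cvg_cst.
apply: (@continuous_comp _ _ _ (fun x => a * x + b) expR); last first.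
  exact: continuous_expR.
by apply: differentiable_continuous; apply/derivable1_diffP; exact: ex_derive.
Qed.

Lemma AC_sinh a b :
  abs_cont L (fun x => sinh (a * x + b)) (fun x => a * cosh (a * x + b)).
Proof.
apply: AC_eq (ACZ 2^-1 (ACB (AC_expR a b) (AC_expR (- a) (- b)))) => x _;
  rewrite /sinh /cosh (_ : - a * x - b = - (a * x + b)); by [field|ring].
Qed.

Lemma AC_cosh a b :
  abs_cont L (fun x => cosh (a * x + b)) (fun x => a * sinh (a * x + b)).
Proof.
apply: AC_eq (ACZ 2^-1 (ACD (AC_expR a b) (AC_expR (- a) (- b)))) => x _;
  rewrite /sinh /cosh (_ : - a * x - b = - (a * x + b)); by [field|ring].
Qed.

End absolutely_continuous.

(** * Hyperbolic functions *)

Section hyperbolic.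
Context {R : realType}.
Implicit Types x y : R.

Lemma sinhD x y : sinh (x + y) = sinh x * cosh y + cosh x * sinh y.
Proof. by rewrite /sinh /cosh opprD !expRD; field. Qed.

Lemma sinh0 : sinh 0 = 0 :> R.
Proof. by rewrite /sinh oppr0 subrr mul0r. Qed.

Lemma sinh_gt0 x : 0 < x -> 0 < sinh x.
Proof. by move=> x0; rewrite /sinh divr_gt0// subr_gt0 ltr_expR; lra. Qed.

Lemma cosh2B_sinh2 x : cosh x ^+ 2 - sinh x ^+ 2 = 1.
Proof.
have e : expR x * expR (- x) = 1 by rewrite -expRD subrr expR0.
by rewrite -e /sinh /cosh; field.
Qed.

End hyperbolic.

(** * The Green function and the local problem y'''' - M y'' = q *)

Section green.
Context {R : realType} {L M : R}.
Hypotheses (L0 : 0 < L) (M0 : 0 < M).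
Local Notation m := (Num.sqrt M).
Implicit Types (y q : R -> R) (x s : R).

Let zL : 0 \in `[0, L].
Proof. by rewrite in_itv /= lexx ltW. Qed.

Let LL : L \in `[0, L].
Proof. by rewrite in_itv /= lexx ltW. Qed.

Let m0 : 0 < m. Proof. by rewrite sqrtr_gt0. Qed.

Let mm : m * m = M. Proof. by rewrite -expr2 sqr_sqrtr// ltW. Qed.

Let smL : 0 < sinh (m * L). Proof. by rewrite sinh_gt0// mulr_gt0. Qed.

Lemma W41P y y1 y2 y3 y4 : W41 L y y1 y2 y3 y4 <->
  [/\ abs_cont L y y1, abs_cont L y1 y2, abs_cont L y2 y3 & abs_cont L y3 y4].
Proof.
split=> [[i1 i2 i3 i4 H]|[[i1 h1] [i2 h2] [i3 h3] [i4 h4]]].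
  by split; split => // x /H[].
by split => // x xL; split; [exact: h1|exact: h2|exact: h3|exact: h4].
Qed.

(** As a function of s, each branch of G(x, s) has this form, with a = m for s <= x and a = -m for s
    >= x. *)
Lemma AC_kernel (c d k a b : R) :
  abs_cont L (fun s => c * s + d - k * sinh (a * s + b))
  (fun s => c - k * (a * cosh (a * s + b))).
Proof.
apply: AC_eq (ACB (ACD (ACZ c AC_id) (AC_cst d))
  (ACZ k (AC_sinh a b))) => s _ //=; ring.
Qed.

(** Lagrange's identity: for g(s) = c s + d - k sinh(a s + b) one has g'''' = M g'', so g y''' - g'
    y'' + g'' y' - g''' y - M (g y' - g' y) has derivative g (y'''' - M y''). Since g'' - M g = -M
    (c s + d), the terms in y' and y involve only the affine part of g. *)
Lemma AC_green (c d k a b : R) y y1 y2 y3 y4 : a * a = M ->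
  W41 L y y1 y2 y3 y4 ->
  abs_cont L (fun s => (c * s + d - k * sinh (a * s + b)) * y3 s -
                 (c - k * (a * cosh (a * s + b))) * y2 s -
                 M * ((c * s + d) * y1 s - c * y s))
       (fun s => (c * s + d - k * sinh (a * s + b)) * (y4 s - M * y2 s)).
Proof.
move=> aM /W41P[Ay Ay1 Ay2 Ay3].
have Ag := AC_kernel c d k a b.
have Ag1 : abs_cont L (fun s => c - k * (a * cosh (a * s + b)))
    (fun s => - k * (M * sinh (a * s + b))).
  apply: AC_eq (ACB (AC_cst c)
    (ACZ (k * a) (AC_cosh a b))) => s _ //=; rewrite -?aM; ring.
have Al : abs_cont L (fun s => c * s + d) (fun s => c).
  apply: AC_eq (ACD (ACZ c AC_id) (AC_cst d)) => s _ //=; ring.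
apply: AC_eq (ACB (ACB (ACM Ag Ay3)
   (ACM Ag1 Ay2)) (ACZ M (ACB
   (ACM Al Ay1) (ACZ c Ay)))) => s _ //=; ring.
Qed.

Let c1 x := (L - x) / (M * L).
Let k1 x := sinh (m * (L - x)) / (M * m * sinh (m * L)).
Let k2 x := sinh (m * x) / (M * m * sinh (m * L)).

Let G_le x s : s <= x ->
  G M L x s = c1 x * s + 0 - k1 x * sinh (m * s + 0).
Proof.
move=> sx; rewrite /G /= !addr0; case: (leP x s) => xs; last first.
  by rewrite /c1 /k1; field; rewrite !gt_eqF.
have -> : s = x by lra.
by rewrite /c1 /k1; field; rewrite !gt_eqF.
Qed.

Let G_ge x s : x <= s ->
  G M L x s = - x / (M * L) * s + x / M - k2 x * sinh (- m * s + m * L).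
Proof.
rewrite /G /= => ->; rewrite (_ : - m * s + m * L = m * (L - s)); last by ring.
by rewrite /k2; field; rewrite !gt_eqF.
Qed.

Lemma L1_green x q : L1 L q -> L1 L (fun s => G M L x s * q s).
Proof.
move=> qi.
have lei (c d k a b : R) :
    L1 L (fun s => (c * s + d - k * sinh (a * s + b)) * q s).
  by apply: L1_eq (L1M qi (AC_kernel c d k a b)) => s _; rewrite mulrC.
apply: (@L1_eq _ _ (fun s => if x <= s
  then (- x / (M * L) * s + x / M - k2 x * sinh (- m * s + m * L)) * q s
  else (c1 x * s + 0 - k1 x * sinh (m * s + 0)) * q s)).
  by move=> s _; case: leP => h; [rewrite G_ge|rewrite (G_le _ _ (ltW h))].
apply: L1_if; [exact: measurable_fun_ler|exact: lei|exact: lei].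
Qed.

(** The boundary terms at 0 and L vanish, because y, y'', the kernel and its affine part do. At s =
    x the two branches agree in value, in s-derivative and in the value of the affine part. Only the
    slope of the affine part jumps, by 1/M, and this leaves y(x). *)
Lemma green_repr y y1 y2 y3 y4 x : W41 L y y1 y2 y3 y4 ->
  y 0 = 0 -> y L = 0 -> y2 0 = 0 -> y2 L = 0 -> x \in `[0, L] ->
  Iab 0 L (fun s => G M L x s * (y4 s - M * y2 s)) = y x.
Proof.
move=> W y0 yL y20 y2L xL.
have [_ i2 _ i4 _] := W.
have x0L : 0 <= x <= L by move: xL; rewrite in_itv.
rewrite (Iab_split zL LL xL (L1_green x _ (L1B i4 (L1Z M i2)))).
have NmM : - m * - m = M by rewrite mulrNN.
have HL := AC_green (c1 x) 0 (k1 x) m 0 _ _ _ _ _ mm W.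
have HR := AC_green (- x / (M * L)) (x / M) (k2 x) (- m) (m * L) _ _ _ _ _ NmM W.
rewrite (@Iab_eq _ (fun s => G M L x s * _) (fun s => (c1 x * s + 0 -
   k1 x * sinh (m * s + 0)) * (y4 s - M * y2 s))); last first.
  by move=> s; rewrite in_itv /= => sx; rewrite G_le//; lra.
rewrite (AC_increment zL xL _ HL); last by lra.
rewrite (@Iab_eq _ (fun s => G M L x s * _) (fun s => (- x / (M * L) * s + x / M -
   k2 x * sinh (- m * s + m * L)) * (y4 s - M * y2 s))); last first.
  by move=> s; rewrite in_itv /= => sx; rewrite G_ge//; lra.
rewrite (AC_increment xL LL _ HR); last by lra.
rewrite /= y0 yL y20 y2L !addr0 !mulr0 sinh0.
have -> : - m * L + m * L = 0 by ring.
have -> : - m * x + m * L = m * (L - x) by ring.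
(* The addition formula makes the s-derivatives of the two branches agree at s = x, which removes
   [y2 x]. *)
have := sinhD (m * x) (m * (L - x)).
rewrite (_ : m * x + m * (L - x) = m * L); last by ring.
move=> e; move: smL; rewrite sinh0 /c1 /k1 /k2 e => smL'.
field; rewrite !gt_eqF//.
Qed.

Lemma green_solve q : L1 L q -> exists y y1 y2 y3,
  [/\ W41 L y y1 y2 y3 (fun s => M * y2 s + q s),
      y 0 = 0, y L = 0, y2 0 = 0 & y2 L = 0].
Proof.
move=> qi.
pose S x := sinh (m * x); pose C x := cosh (m * x).
have AS : abs_cont L S (fun x => m * C x).
  by apply: AC_eq (AC_sinh m 0) => x _; rewrite addr0.
have ACC : abs_cont L C (fun x => m * S x).
  by apply: AC_eq (AC_cosh m 0) => x _; rewrite addr0.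
have A1 := AC_Iab (L1M qi ACC); set F1 := Iab 0 ^~ _ in A1.
have A2 := AC_Iab (L1M qi AS); set F2 := Iab 0 ^~ _ in A2.
(* [A] is the coefficient for which [w L = 0]. *)
pose A := - (S L * F1 L - C L * F2 L) / (m * S L).
(* The second term is m^-1 \int_0^x sinh(m (x - s)) q(s) ds, split by the subtraction formula. In
   its derivative the terms S (q C) - C (q S) cancel; differentiating again leaves q (C^2 - S^2) =
   q. *)
pose w x := A * S x + m^-1 * (S x * F1 x - C x * F2 x).
pose w1 x := A * m * C x + (C x * F1 x - S x * F2 x).
have CS x : C x * C x - S x * S x = 1 by rewrite -!expr2 cosh2B_sinh2.
have Aw : abs_cont L w w1.
  apply: AC_eq (ACD (ACZ A AS) (ACZ m^-1 (ACB
    (ACM AS A1) (ACM ACC A2)))) => x _ //.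
  by rewrite /w1; field; rewrite gt_eqF.
have Aw1 : abs_cont L w1 (fun x => M * w x + q x).
  apply: AC_eq (ACD (ACZ (A * m) ACC) (ACB
    (ACM ACC A1) (ACM AS A2))) => x _ //.
  have -> : M * w x = A * m * (m * S x) + m * (S x * F1 x - C x * F2 x).
    by rewrite -[X in X * _]mm /w; field; rewrite gt_eqF.
  by rewrite -[in RHS](mulr1 (q x)) -(CS x); ring.
have AI := AC_Iab (L1_AC Aw); set I1 := Iab 0 ^~ _ in AI.
have AJ := AC_Iab (L1_AC AI); set I2 := Iab 0 ^~ _ in AJ.
(* [B] is the slope for which y vanishes at L. *)
pose B := - I2 L / L.
exists (fun x => B * x + I2 x), (fun x => B + I1 x), w, w1; split.
- apply/W41P; split => //.
  + by apply: AC_eq (ACD (ACZ B AC_id) AJ) => x _ //=; rewrite mulr1.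
  + by apply: AC_eq (ACD (AC_cst B) AI) => x _ //=; rewrite add0r.
- by rewrite /I2 Iab_id; ring.
- by rewrite /B; field; rewrite gt_eqF.
- by rewrite /w /S mulr0 sinh0 /F2 Iab_id; ring.
- by rewrite /w /A; field; rewrite !gt_eqF.
Qed.

(** By [green_repr] the Green integral agrees on [0, L] with the solution from [green_solve] and
    inherits its derivatives. *)
Lemma green_W41 q : L1 L q -> let y x := Iab 0 L (fun s => G M L x s * q s) in
  exists y1 y2 y3, [/\ W41 L y y1 y2 y3 (fun s => M * y2 s + q s),
      y 0 = 0, y L = 0, y2 0 = 0 & y2 L = 0].
Proof.
move=> qi /=; have [y [y1 [y2 [y3 [W y0 yL y20 y2L]]]]] := green_solve q qi.
have E x : x \in `[0, L] -> y x = Iab 0 L (fun s => G M L x s * q s).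
  move=> xL; rewrite -(green_repr _ _ _ _ _ x W)//.
  by apply: Iab_eq => s _; congr (_ * _); ring.
exists y1, y2, y3; rewrite -!E//; split => //.
apply/W41P; move/W41P : W => [Ay Ay1 Ay2 Ay3]; split => //.
by apply: AC_eq Ay.
Qed.

(** The upper bound is the integral of x (L - x) / (2 M), which solves the problem with right-hand
    side 1 and no fourth-order term. *)
Lemma green_mean_bounds :
  0 <= Iab 0 L (fun x => Iab 0 L (fun s => G M L x s)) <= L ^+ 3 / (12 * M).
Proof.
have [u1 [u2 [u3 [W u0 uL u20 u2L]]]] := green_W41 _ (L1_cst 1).
pose u x := Iab 0 L (fun s => G M L x s).
have uE x : Iab 0 L (fun s => G M L x s * 1) = u x.
  by apply: Iab_eq => s _; rewrite mulr1.
move: W u0 uL; rewrite (funext uE) !uE -/(Iab 0 L u) => W u0 uL.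
have [Au Au1 Au2 Au3] := (W41P _ _ _ _ _).1 W.
have ui := L1_AC Au.
have i1 := L1M (L1_AC Au1) Au1.
have i2 := L1M (L1_AC Au2) Au2.
(* The equation u'''' - M u'' = 1 multiplied by u. *)
have E1 : Iab 0 L (fun x => u x - (u2 x * u2 x + M * (u1 x * u1 x))) = 0.
  have A1 : abs_cont L (fun x => u x * u3 x - u1 x * u2 x - M * (u x * u1 x))
      (fun x => u x - (u2 x * u2 x + M * (u1 x * u1 x))).
    apply: AC_eq (ACB (ACB (ACM Au Au3)
      (ACM Au1 Au2)) (ACZ M (ACM Au Au1))) => x _ //; ring.
  rewrite (AC_increment zL LL (ltW L0) A1) u0 uL u20 u2L; ring.
have E : Iab 0 L u = Iab 0 L (fun x => u2 x * u2 x + M * (u1 x * u1 x)).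
  apply: subr0_eq; rewrite -(@IabB _ L)//.
  by apply: L1D => //; exact: L1Z.
rewrite -[Iab 0 L _]/(Iab 0 L u) E Rintegral_ge0 /=; last first.
  by move=> x _; rewrite -!expr2 addr_ge0 ?sqr_ge0// mulr_ge0 ?sqr_ge0 ?(ltW M0).
rewrite -E.
(* v1 is the derivative of v = x (L - x) / (2 M), which satisfies - M v'' = 1
   and v(0) = v(L) = 0: \int u = M \int u' v', and completing the square gives
   the bound M \int v'^2 = L^3 / (12 M). *)
pose v1 x := (L - 2 * x) / (2 * M).
have E2 : Iab 0 L (fun x => (u2 x * u2 x + M * (u1 x - v1 x) ^+ 2) + u x) =
    L ^+ 3 / (12 * M).
  have Ax := @AC_id R L.
  have Ax2 := ACM Ax Ax.
  have Ax3 := ACM Ax Ax2.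
  have Al : abs_cont L (fun x => L - 2 * x) (fun=> -2).
    apply: AC_eq (ACB (AC_cst L) (ACZ 2 Ax)) => x _ //=; ring.
  (* The cubic is a primitive of M v1^2 = (L - 2 x)^2 / (4 M). It alone contributes to the increment
     of [P], since u and u'' vanish at both ends. *)
  pose P x := u1 x * u2 x + M * (u x * u1 x) - u x * u3 x - (L - 2 * x) * u x
     + (4 * M)^-1 * (L ^+ 2 * x - 2 * L * (x * x) + 4 / 3 * (x * (x * x))).
  have A2 : abs_cont L P (fun x => (u2 x * u2 x + M * (u1 x - v1 x) ^+ 2) + u x).
    have AQ := ACZ (4 * M)^-1 (ACD (ACB (ACZ (L ^+ 2) Ax)
      (ACZ (2 * L) Ax2)) (ACZ (4 / 3) Ax3)).
    apply: AC_eq (ACD (ACB (ACB (ACD (ACM Au1 Au2)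
      (ACZ M (ACM Au Au1))) (ACM Au Au3)) (ACM Al Au)) AQ) => x _ //.
    by rewrite /v1 /=; field; rewrite gt_eqF.
  rewrite (AC_increment zL LL (ltW L0) A2) /P u0 uL u20 u2L.
  by field; rewrite gt_eqF.
have v1A : abs_cont L v1 (fun=> - M^-1).
  apply: AC_eq (ACZ (2 * M)^-1 (ACB (AC_cst L) (ACZ 2 AC_id))) => x _.
    by rewrite mulrC.
  by field; rewrite gt_eqF.
have di := ACB Au1 v1A.
have ei : L1 L (fun x => u2 x * u2 x + M * (u1 x - v1 x) ^+ 2).
  by apply: L1D => //; apply: L1Z; apply: L1_eq (L1M (L1_AC di) di).
rewrite -E2 (@IabD _ L)// lerDr Rintegral_ge0// => x _.
by rewrite -expr2 addr_ge0 ?sqr_ge0// mulr_ge0 ?sqr_ge0 ?(ltW M0).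
Qed.

End green.

(** * The nonlocal problem *)

Section nonlocal.
Context {R : realType} {L M N : R}.
Hypotheses (L0 : 0 < L) (M0 : 0 < M) (N_le : `|N| <= 8 * M / L ^+ 3).
Implicit Types (p y : R -> R) (x : R).

Let zL : 0 \in `[0, L].
Proof. by rewrite in_itv /= lexx ltW. Qed.

Let LL : L \in `[0, L].
Proof. by rewrite in_itv /= lexx ltW. Qed.

Local Notation V q := (fun x => Iab 0 L (fun s => G M L x s * q s)).
Local Notation u := (fun x => Iab 0 L (fun s => G M L x s)).
Local Notation D := (1 + N * Iab 0 L u).
Local Notation c p := (Iab 0 L (V p) / D).

(** The two bounds multiply to (8 M / L^3) (L^3 / (12 M)) = 2/3, so the denominator is at least
    1/3. *)
Lemma nonlocal_denom_gt0 : 0 < D.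
Proof.
have /andP[U0 U1] := green_mean_bounds L0 M0.
have H : `|N| * Iab 0 L u <= 2 / 3.
  apply: le_trans (ler_pM (normr_ge0 _) U0 N_le U1) _.
  by rewrite le_eqVlt; apply/orP; left; apply/eqP; field; rewrite !gt_eqF.
have : - (`|N| * Iab 0 L u) <= N * Iab 0 L u.
  by rewrite -mulNr ler_wpM2r// lerNl ler_normr lexx orbT.
lra.
Qed.

Lemma green_one x : Iab 0 L (fun s => G M L x s * 1) = u x.
Proof. by apply: Iab_eq => s _; rewrite mulr1. Qed.

Lemma green_sub p k x : L1 L p ->
  Iab 0 L (fun s => G M L x s * (p s - k)) = V p x - k * u x.
Proof.
move=> pi; rewrite /= -green_one -(IabZ k zL LL); last exact: L1_green (L1_cst 1).
rewrite -(IabB zL LL); last 2 first.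
- exact: L1_green.
- by apply: L1Z; exact: L1_green (L1_cst 1).
by apply: Iab_eq => s _; ring.
Qed.

(** Here [c p] is the value forced on \int y, and N c is the constant to be subtracted from p. *)
Lemma sol_formulaE p x : sol_formula M N L p x = V p x - N * c p * u x.
Proof. by rewrite /sol_formula; field; rewrite gt_eqF// nonlocal_denom_gt0. Qed.

Lemma sol_formula_solution p : L1 L p ->
  is_solution M N L p (sol_formula M N L p).
Proof.
move=> pi; set k := N * c p.
have [v1 [v2 [v3 [Wv v0 vL v20 v2L]]]] := green_W41 L0 M0 _ pi.
have [u1 [u2 [u3 []]]] := green_W41 L0 M0 _ (@L1_cst R L 1).
rewrite (funext green_one) !green_one => Wu u0 uL u20 u2L.
have [Av Av1 Av2 Av3] := (W41P _ _ _ _ _).1 Wv.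
have [Au Au1 Au2 Au3] := (W41P _ _ _ _ _).1 Wu.
have lin (F f H h : R -> R) : abs_cont L F f -> abs_cont L H h ->
    abs_cont L (fun x => F x - k * H x) (fun x => f x - k * h x).
  by move=> AF AH; exact: ACB AF (ACZ k AH).
rewrite (funext (sol_formulaE p)).
(* The fourth derivative is read off from the local equations, so the nonlocal equation holds at
   every point. *)
exists (fun x => v1 x - k * u1 x), (fun x => v2 x - k * u2 x),
  (fun x => v3 x - k * u3 x), (fun x => (M * v2 x + p x) - k * (M * u2 x + 1)).
split.
- by apply/W41P; split; exact: lin.
(* Consistency of the constant: \int V p = c D gives \int (V p - N c u) = c D - N c \int u = c. *)
- have -> : Iab 0 L (fun x => V p x - k * u x) = c p.
    rewrite (IabB zL LL (L1_AC Av) (L1Z k (L1_AC Au))).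
    rewrite (IabZ k zL LL (L1_AC Au)) /k.
    by field; rewrite gt_eqF// nonlocal_denom_gt0.
  by apply: aeW => x _; rewrite /k; ring.
- by rewrite v0 vL v20 v2L u0 uL u20 u2L; split; ring.
Qed.

(** With k = N \int y treated as a constant, the equation is local with right-hand side p - k. Hence
    y = V p - k u, and only the number \int y remains to be determined. *)
Lemma solution_unique p y : L1 L p -> is_solution M N L p y ->
  {in `[0, L], y =1 sol_formula M N L p}.
Proof.
move=> pi [y1 [y2 [y3 [y4 [W eqy [y0 yL y20 y2L]]]]]].
set k := N * Iab 0 L y in eqy.
have [_ i2 _ i4 _] := W.
have yE : {in `[0, L], y =1 (fun x => V p x - k * u x)}.
  move=> x xL; rewrite -(green_repr L0 M0 _ _ _ _ _ _ W y0 yL y20 y2L xL).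
  rewrite -green_sub//.
  have Gi := L1_green L0 M0 x _ (L1B i4 (L1Z M i2)).
  have Gk := L1_green L0 M0 x _ (L1B pi (L1_cst k)).
  apply: Iab_ae_eq => //.
  move: eqy; apply: filterS; first exact: (ae_filter_ringOfSetsType (@leb R)).
  by move=> s /[swap] sL /(_ sL) <-; ring.
have [v1 [v2 [v3 [Wv _ _ _ _]]]] := green_W41 L0 M0 _ pi.
have [u1 [u2 [u3 []]]] := green_W41 L0 M0 _ (@L1_cst R L 1).
rewrite (funext green_one) => Wu _ _ _ _.
have [Av _ _ _] := (W41P _ _ _ _ _).1 Wv.
have [Au _ _ _] := (W41P _ _ _ _ _).1 Wu.
have : Iab 0 L y = Iab 0 L (V p) - k * Iab 0 L u.
  rewrite (Iab_eq yE) (IabB zL LL (L1_AC Av) (L1Z k (L1_AC Au))).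
  by rewrite (IabZ k zL LL (L1_AC Au)).
move=> e x xL; rewrite yE// sol_formulaE; congr (_ - _ * _).
(* Integrating y = V p - k u and inserting k = N \int y gives a linear equation for \int y with
   coefficient [D]. *)
have -> : Iab 0 L (V p) = Iab 0 L y * D.
  by rewrite -[LHS](subrK (k * Iab 0 L u)) -e /k; ring.
by rewrite mulfK// gt_eqF// nonlocal_denom_gt0.
Qed.

End nonlocal.

Theorem theorem2p1 (R : realType) (L M N : R) :
  0 < L -> 0 < M -> `|N| <= 8 * M / L ^+ 3 ->
  forall p : R -> R, L1 L p ->
    is_solution M N L p (sol_formula M N L p) /\
    (forall y : R -> R, is_solution M N L p y ->
       forall x, x \in `[0, L] -> y x = sol_formula M N L p x).
Proof.
move=> L0 M0 N_le p pi; split; first exact: sol_formula_solution.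
by move=> y sy; exact: solution_unique sy.
Qed.
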